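(* Let $G=(V,A)$ be a directed acyclic graph with source $s$, target $t$ and symmetric cost matrix $Q\in\mathbb{R}^{m\times m}$ satisfying the standing assumptions in the context, and let $G_v,Q_v,R_v,p_v$ $(v\in V)$ and $T_e$ $(e\in A)$ be as defined in the context. Then the pseudo-linearization vector $p_t$ is a linearization vector of $Q_t$ if and only if $$(R_u\circ T_e)(p_v)=p_u\quad\text{for every } e=(u,v)\in A.$$
   Context: **Setting.** $G=(V,A)$ is a directed acyclic graph with $n$ vertices and $m$ arcs; the vertices $v_1,\dots,v_n$ are topologically sorted ($(v_i,v_j)\in A$ implies $i<j$), $s=v_1$, $t=v_n$; every vertex lies on at least one $s$-$t$ path. $Q=(q_{e,f})_{e,f\in A}$ is a real symmetric matrix (the interaction cost of two distinct arcs $e,f$ is $2q_{e,f}$) with zero diagonal. The arcs carry a fixed labeling (indices). The cost of an $s$-$t$ path with characteristic vector $x\in\{0,1\}^A$ is $x^{\mathrm T}Qx$. **Linearization.** A vector $c\in\mathbb{R}^A$ is a linearization vector (linearization) of $Q$ if $x^{\mathrm T}Qx=c^{\mathrm T}x$ for the characteristic vector $x$ of every $s$-$t$ path. **Basic arcs.** The vertices other than $s$ and $t$ are transshipment vertices. For each transshipment vertex, its outgoing arc with smallest index is called non-basic; all other arcs are basic. **Reduced form.** Cost vectors $c_1,c_2$ are equivalent if $c_1^{\mathrm T}x=c_2^{\mathrm T}x$ for every characteristic vector $x$ of an $s$-$t$ path. The reduced form $R(c)$ of $c$ is the cost vector equivalent to $c$ with $(R(c))_e=0$ for every non-basic arc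 $e$. **Critical paths.** For each basic arc $e=(u,w)$ fix a critical path $P_e$: the concatenation of an arbitrarily chosen $s$-$u$ path, the arc $e$, and the unique $w$-$t$ path consisting only of non-basic arcs. **Pseudo-linearization vector.** This is the unique cost vector $p$ with $p_e=0$ for all non-basic arcs $e$ and $x^{\mathrm T}Qx=p^{\mathrm T}x$ for the characteristic vector $x$ of each of the fixed critical paths. **Changing the target.** For $v\in V$, $G_v=(V_v,A_v)$ is the subgraph of $G$ induced by the vertices lying on some $s$-$v$ path (so every vertex of $G_v$ lies on an $s$-$v$ path; $G_t=G$; $G_s$ has the single vertex $s$ and no arcs). $Q_v$ is the submatrix of $Q$ with rows and columns indexed by $A_v$ ($Q_t=Q$). All the notions above are applied to the instance $(G_v,s,v,Q_v)$ (with target $v$, non-basic arcs and critical paths taken in $G_v$): $R_v(\cdot)$ maps a cost vector on $A_v$ to its reduced form with respect to $G_v$, and $p_v\in\mathbb{R}^{A_v}$ is the pseudo-linearization vector of $Q_v$. For $v=s$ all these vectors are empty. **The map $T_e$.** For an arc $e=(u,v)\in A$ and a cost vector $c\in\mathbb{R}^{A_v}$, $T_e(c)\in\mathbb{R}^{A_u}$ is defined, for $e'=(a,w)\in A_u$, by $(T_e(c))_{e'}=c_{e'}-2q_{e,e'}$ if $a\ne s$, and $(T_e(c))_{e'}=c_{e'}-2q_{e,e'}+c_e$ if $a=s$. *)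

(* Defs.v *)
From HB Require Import structures.
From mathcomp Require Import all_boot all_order all_algebra.
From mathcomp Require Import boolp classical_sets reals.

Set Implicit Arguments.
Unset Strict Implicit.
Unset Printing Implicit Defensive.

Import Order.TTheory GRing.Theory Num.Theory.
Local Open Scope ring_scope.

(* A simple DAG with [n.+1] topologically sorted vertices and [m] arcs.
   Arcs are identified with their labels in ['I_m]. *)
Record dag (n m : nat) := Dag {
  src : 'I_m -> 'I_n.+1;
  dst : 'I_m -> 'I_n.+1;
  arc_inj : injective (fun e => (src e, dst e));
  topological : forall e, (src e < dst e)%N
}.

Section Graph.
Variables (n m : nat) (G : dag n m).
Implicit Types (u v w x : 'I_n.+1) (e f : 'I_m) (p : seq 'I_m).

Definition source : 'I_n.+1 := ord0.
Definition target : 'I_n.+1 := ord_max.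

(* A path is the sequence of its arcs. *)
Fixpoint dipath u p w : bool :=
  if p is e :: p' then (src G e == u) && dipath (dst G e) p' w else u == w.

(* Vertex [x] lies on some [u]-[w] path. *)
Definition on_path u w x : Prop :=
  exists p, dipath u p w /\ x \in u :: map (dst G) p.

(* G_v denotes the subgraph induced by the vertices lying on some source-v
   path; it is given by [vertices_to v] and [arcs_to v]. *)
Definition vertices_to v : {set 'I_n.+1} :=
  [set x | `[< on_path source v x >]]%SET.

Definition arcs_to v : {set 'I_m} :=
  [set e | (src G e \in vertices_to v) && (dst G e \in vertices_to v)]%SET.

(* [u]-[w] paths of G_v. *)
Definition dipath_in v u p w : bool :=
  dipath u p w && all (fun e => e \in arcs_to v) p.

Definition transshipment v x : bool :=
  [&& x \in vertices_to v, x != source & x != v].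

Definition nonbasic v e : bool :=
  [&& e \in arcs_to v, transshipment v (src G e) &
      [forall f, (f \in arcs_to v) && (src G f == src G e) ==> (e <= f)%N]].

Definition basic v e : bool := (e \in arcs_to v) && ~~ nonbasic v e.

Definition critical_path v e p : Prop :=
  exists p1 p2,
    [/\ p = p1 ++ e :: p2,
        dipath_in v source p1 (src G e),
        dipath_in v (dst G e) p2 v
      & all (nonbasic v) p2].

Section Costs.
Variables (R : realType) (Q : 'M[R]_m).
Implicit Types c r : 'cV[R]_m.

Definition charvec p : 'cV[R]_m := \col_e (e \in p)%:R.

(* Vectors indexed by the arcs of G_v, and the submatrix Q_v, are encoded
   as vectors and matrices over all arcs, extended by zero. *)
Definition cost_vector v c : Prop := forall e, e \notin arcs_to v -> c e 0 = 0.

Definition submatrix_to v : 'M[R]_m :=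
  \matrix_(e, f)
    if (e \in arcs_to v) && (f \in arcs_to v) then Q e f else 0.

Definition lin_cost c p : R := (c^T *m charvec p) 0 0.

Definition quad_cost v p : R :=
  ((charvec p)^T *m submatrix_to v *m charvec p) 0 0.

Definition linearization v c : Prop :=
  cost_vector v c /\
  forall p, dipath_in v source p v -> quad_cost v p = lin_cost c p.

Definition equivalent_costs v c1 c2 : Prop :=
  forall p, dipath_in v source p v -> lin_cost c1 p = lin_cost c2 p.

Definition is_reduced_form v c r : Prop :=
  [/\ cost_vector v r, equivalent_costs v c r
    & forall e, nonbasic v e -> r e 0 = 0].

(* Definite description: when every vertex of G lies on a source-target path,
   exactly one vector satisfies [is_reduced_form v c], and likewise below for
   [is_pseudo_linearization v P] with critical paths [P]; the default 0 of
   [xget] plays no role. *)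
Definition reduced_form v c : 'cV[R]_m := xget 0 (is_reduced_form v c).

(* [P e] is the critical path chosen for the basic arc [e] of G_v. *)
Definition is_pseudo_linearization v (P : 'I_m -> seq 'I_m) c : Prop :=
  [/\ cost_vector v c, forall e, nonbasic v e -> c e 0 = 0
    & forall e, basic v e -> quad_cost v (P e) = lin_cost c (P e)].

Definition pseudo_linearization v (P : 'I_m -> seq 'I_m) : 'cV[R]_m :=
  xget 0 (is_pseudo_linearization v P).

(* The map T_e from cost vectors on G_(dst e) to cost vectors on G_(src e). *)
Definition pull_back e c : 'cV[R]_m :=
  \col_e'
    if e' \in arcs_to (src G e) then
      if src G e' == source then c e' 0 - 2 * Q e e' + c e 0
      else c e' 0 - 2 * Q e e'
    else 0.

End Costs.
End Graph.

Arguments source {n}.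
Arguments target {n}.

(* Main.v *)
(* Appending the arc e = (u, v) to an s-u path x increases the quadratic cost by
   2 sum_f q_{e,f} x_f, and T_e is built so that T_e(c)(x) = c(x + e) minus this
   increment (for u <> s).  Hence, if p_v linearizes Q_v, then T_e(p_v) agrees with
   the quadratic cost on all s-u paths, so its reduced form solves the system
   defining p_u; the solution is unique, and p_u linearizes Q_u.  Descending
   from t gives one direction.  Conversely, if p_u linearizes Q_u for all
   predecessors u of v, the identities carry this over to p_v. *)
Require Import Defs.
From HB Require Import structures.
From mathcomp Require Import all_boot all_order all_algebra.
From mathcomp Require Import boolp classical_sets reals.
From mathcomp Require Import zify.

Set Implicit Arguments.
Unset Strict Implicit.
Unset Printing Implicit Defensive.

Import Order.TTheory GRing.Theory Num.Theory.
Local Open Scope ring_scope.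

(** Turns uniqueness into existence for square systems; it supplies both the vertex potential and
    the pseudo-linearization vector. *)
Lemma solvable_of_injective (F : fieldType) k (M : 'M[F]_k) (b : 'cV[F]_k) :
  (forall x : 'cV[F]_k, M *m x = 0 -> x = 0) -> exists x, M *m x = b.
Proof.
move=> Minj; suff Mu : M \in unitmx by exists (invmx M *m b); rewrite mulKVmx.
(* [det0P] yields a left kernel vector, so the determinant is transposed first. *)
rewrite unitmxE unitfE; apply/negP; rewrite -det_tr => /det0P[x /negP x0 xM].
apply: x0; rewrite -(inj_eq (@trmx_inj _ _ _)) trmx0; apply/eqP/Minj.
by rewrite -[M]trmxK -trmx_mul xM trmx0.
Qed.

(** * Paths in a topologically sorted graph *)

Section Paths.
Variables (n m : nat) (G : dag n m).
Implicit Types (u v w x : 'I_n.+1) (e f : 'I_m) (p : seq 'I_m).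

Lemma dipath_cat u x w p1 p2 :
  dipath G u p1 x -> dipath G x p2 w -> dipath G u (p1 ++ p2) w.
Proof.
elim: p1 u => [|e p1 IH] u /=; first by move/eqP->.
by case/andP=> -> /IH.
Qed.

Lemma dipath_split u w e p1 p2 :
  dipath G u (p1 ++ e :: p2) w ->
  dipath G u p1 (src G e) /\ dipath G (dst G e) p2 w.
Proof.
elim: p1 u => [|f p1 IH] u /=; first by case/andP=> /eqP-> ->.
by case/andP=> -> /IH.
Qed.

Lemma dipath_rcons u w e p :
  dipath G u (rcons p e) w = dipath G u p (src G e) && (dst G e == w).
Proof.
by elim: p u => [|f p IH] u /=; [rewrite eq_sym | rewrite IH andbA].
Qed.

Lemma dipath_last u w p : dipath G u p w -> last u (map (dst G) p) = w.
Proof. by elim: p u => [|e p IH] u /=; [move/eqP | case/andP=> _ /IH]. Qed.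

Lemma dipath_src_ge u w p e : dipath G u p w -> e \in p -> (u <= src G e)%N.
Proof.
elim: p u => [//|f p IH] u /= /andP[/eqP <- pP]; rewrite inE.
case/orP=> [/eqP->//|/(IH _ pP)]; apply: leq_trans.
exact/ltnW/topological.
Qed.

Lemma dipath_le u w p : dipath G u p w -> (u <= w)%N.
Proof.
elim: p u => [|f p IH] u /=; first by move/eqP->.
by case/andP=> /eqP<- /IH; apply/leq_trans/ltnW/topological.
Qed.

Lemma dipath_src_lt u w p e : dipath G u p w -> e \in p -> (src G e < w)%N.
Proof.
move=> pP /splitPr ep; case: ep pP => p1 p2 /dipath_split[_ /dipath_le].
exact/leq_trans/topological.
Qed.

(** Tails strictly increase along a path. Without repeated arcs, products with [charvec] become sums
    over the arc list. *)
Lemma dipath_uniq u w p : dipath G u p w -> uniq p.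
Proof.
elim: p u => [//|e p IH] u /= /andP[_ pP]; rewrite (IH _ pP) andbT.
by apply/negP=> /(dipath_src_ge pP); rewrite leqNgt topological.
Qed.

Lemma dipath_loop u p : dipath G u p u -> p = [::].
Proof.
case: p => // e p /= /andP[/eqP <- /dipath_le].
by rewrite leqNgt topological.
Qed.

Lemma on_pathP u w x :
  on_path G u w x <-> exists p1 p2, dipath G u p1 x /\ dipath G x p2 w.
Proof.
split=> [[p [pP xp]]|[p1 [p2 [p1P p2P]]]]; last first.
  exists (p1 ++ p2); split; first exact: dipath_cat p2P.
  by rewrite map_cat -cat_cons mem_cat -(dipath_last p1P) mem_last.
elim: p u pP xp => [|e p IH] u /=.
  by rewrite inE => uw /eqP->; exists [::], [::]; rewrite /= eqxx.
case/andP=> eu pP; rewrite inE => /orP[/eqP->|/(IH _ pP)[p1 [p2 [p1P p2P]]]].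
  by exists [::], (e :: p); rewrite /= eqxx eu.
by exists (e :: p1), p2; rewrite /= eu.
Qed.

(** Splitting the path at an arc shows that both ends of the arc lie on a source-[v] path, so the
    restriction to G_v is automatic. *)
Lemma dipath_inE v p : dipath_in G v source p v = dipath G source p v.
Proof.
rewrite /dipath_in andbC; case pP: (dipath _ _ _ _); rewrite (andbT, andbF) //.
apply/allP=> e /splitPr ep; case: ep pP => p1 p2 /dipath_split[p1P p2P].
rewrite inE !inE; apply/andP; split; apply/asboolP/on_pathP.
  by exists p1, (e :: p2); rewrite /= eqxx.
by exists (rcons p1 e), p2; rewrite dipath_rcons p1P eqxx.
Qed.

Lemma critical_dipath v e p :
  critical_path G v e p -> dipath_in G v source p v.
Proof.
case=> p1 [p2 [-> /andP[p1P _] /andP[p2P _] _]].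
by rewrite dipath_inE; apply: dipath_cat p1P _; rewrite /= eqxx.
Qed.

Lemma nonbasic_unique v e f :
  nonbasic G v e -> nonbasic G v f -> src G e = src G f -> e = f.
Proof.
case/and3P=> eA _ /forallP eP /and3P[fA _ /forallP fP] ef.
apply/val_inj/anti_leq; move: (eP f) (fP e).
by rewrite eA fA ef eqxx /= => -> ->.
Qed.

End Paths.

(** * Linear and quadratic costs of paths *)

Section Costs.
Variables (n m : nat) (G : dag n m) (R : realType) (Q : 'M[R]_m).
Implicit Types (u v w x : 'I_n.+1) (e f : 'I_m) (p : seq 'I_m) (c r : 'cV[R]_m).

Lemma sum_charvec (F : 'I_m -> R) p :
  uniq p -> \sum_e F e * charvec R p e 0 = \sum_(e <- p) F e.
Proof.
move=> up; rewrite (big_uniq _ up) [RHS]big_mkcond; apply: eq_bigr => e _.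
by rewrite mxE; case: (e \in p); rewrite (mulr1, mulr0).
Qed.

Lemma lin_costE c p : uniq p -> lin_cost c p = \sum_(e <- p) c e 0.
Proof.
move=> up; rewrite /lin_cost mxE -sum_charvec //.
by apply: eq_bigr => e _; rewrite mxE.
Qed.

(** The right side no longer mentions G_v, which makes costs for different targets comparable. *)
Lemma quad_costE v p : dipath G source p v ->
  quad_cost G Q v p = \sum_(e <- p) \sum_(f <- p) Q e f.
Proof.
move=> pP; have up := dipath_uniq pP.
have /allP pA : all (fun e => e \in arcs_to G v) p.
  by move: pP; rewrite -dipath_inE => /andP[].
rewrite /quad_cost mxE sum_charvec // exchange_big /=.
rewrite !big_seq; apply: eq_bigr => f fp; rewrite mxE.
rewrite -[RHS]sum_charvec //.
under eq_bigr do rewrite mxE mulrC.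
rewrite !sum_charvec //.
by rewrite !big_seq; apply: eq_bigr => e ep; rewrite mxE !pA.
Qed.

Lemma lin_costD c r p : lin_cost (c + r) p = lin_cost c p + lin_cost r p.
Proof. by rewrite /lin_cost linearD mulmxDl mxE. Qed.

Lemma lin_costN c p : lin_cost (- c) p = - lin_cost c p.
Proof. by rewrite /lin_cost linearN mulNmx mxE. Qed.

(** The row and the column of [e] contribute equally by symmetry, and the diagonal entry
    vanishes. *)
Lemma quad_cost_rcons e p : Q^T = Q -> Q e e = 0 ->
  dipath G source p (src G e) ->
  quad_cost G Q (dst G e) (rcons p e) =
  quad_cost G Q (src G e) p + \sum_(f <- p) 2 * Q e f.
Proof.
move=> Qsym Qee pP; rewrite !quad_costE ?dipath_rcons ?pP ?eqxx //.
rewrite big_rcons /= big_rcons /= Qee addr0.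
under eq_bigr do rewrite big_rcons /=.
rewrite big_split /= -addrA; congr (_ + _); rewrite -big_split.
by apply: eq_bigr => f _; rewrite -{1}Qsym mxE mulrDl mul1r.
Qed.

(* A path leaves the source exactly once, so it picks up [c e] exactly once. *)
Lemma lin_cost_pull_back e c p : src G e != source ->
  dipath G source p (src G e) ->
  lin_cost (pull_back G Q e c) p =
  lin_cost c (rcons p e) - \sum_(f <- p) 2 * Q e f.
Proof.
move=> es pP; rewrite !lin_costE ?(dipath_uniq pP) //; last first.
  by apply: (@dipath_uniq _ _ G source (dst G e)); rewrite dipath_rcons pP /=.
have /allP pA : all (fun f => f \in arcs_to G (src G e)) p.
  by move: pP; rewrite -dipath_inE => /andP[].
(* Writing the case distinction of [pull_back] as an indicator lets the terms [c e 0] be summed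
   separately. *)
have -> : \sum_(f <- p) pull_back G Q e c f 0 =
   \sum_(f <- p) (c f 0 - 2 * Q e f + (src G f == source)%:R * c e 0).
  rewrite !big_seq; apply: eq_bigr => f fp; rewrite mxE pA //.
  by case: eqP => _; rewrite (mul1r, mul0r) ?addr0.
rewrite big_split /= sumrB big_rcons /= -!addrA; congr (_ + _).
rewrite addrC; congr (_ + _).
case: p pP {pA} => [|f p] /= => [/eqP se|/andP[/eqP fs pP]].
  by rewrite -se eqxx in es.
rewrite big_cons fs eqxx mul1r big_seq big1 ?addr0 // => g gp.
have := dipath_src_ge pP gp; case: eqP => [->|]; last by rewrite mul0r.
by rewrite leqNgt (leq_trans _ (topological G f)).
Qed.

(** * Reduced forms by vertex potentials *)

Lemma sum_potential (h : 'I_n.+1 -> R) u w p : dipath G u p w ->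
  \sum_(e <- p) (h (dst G e) - h (src G e)) = h w - h u.
Proof.
elim: p u => [|e p IH] u /=; first by move/eqP->; rewrite big_nil subrr.
by case/andP=> /eqP <- /IH; rewrite big_cons => ->; rewrite addrC addrA subrK.
Qed.

(* [h x] is the cost of the non-basic path from [x] to [v], and 0 at the
   source, where no arc is non-basic. *)
Lemma exists_potential v c : exists h : 'I_n.+1 -> R,
  forall x, h x = \sum_(e | nonbasic G v e && (src G e == x)) (c e 0 + h (dst G e)).
Proof.
(* [N] is the adjacency matrix of the non-basic arcs, so the required recursion reads
   [h = N *m h + b]. *)
pose N : 'M[R]_n.+1 :=
  \matrix_(x, y) \sum_(e | nonbasic G v e && (src G e == x)) (dst G e == y)%:R.
have NE (h : 'cV[R]_n.+1) x :
    (N *m h) x 0 = \sum_(e | nonbasic G v e && (src G e == x)) h (dst G e) 0.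
  rewrite mxE; under eq_bigr do rewrite mxE mulr_suml.
  rewrite exchange_big; apply: eq_bigr => e _ /=.
  rewrite (bigD1 (dst G e)) //= eqxx mul1r big1 ?addr0 // => y.
  by rewrite eq_sym => /negbTE ->; rewrite mul0r.
pose b : 'cV[R]_n.+1 := \col_x \sum_(e | nonbasic G v e && (src G e == x)) c e 0.
have [] := @solvable_of_injective _ _ (1%:M - N) b.
  move=> h; rewrite mulmxBl mul1mx => /eqP; rewrite subr_eq0 => /eqP hN.
  apply/colP=> x; rewrite [RHS]mxE.
  (* [N] is strictly upper triangular: heads come later in the topological order, so [h = N *m h]
     forces zeros from the last vertex downwards. *)
  have [k] := ubnP (n - x); elim: k x => // k IH x xk.
  rewrite hN NE big1 // => e /andP[_ /eqP ex]; apply: IH.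
  move: xk (topological G e) (ltn_ord (dst G e)); rewrite ex => *; lia.
move=> h hb; exists (fun x => h x 0) => x; rewrite big_split /= -NE.
move/colP/(_ x): hb; rewrite mulmxBl mul1mx !mxE => /eqP.
by rewrite subr_eq => /eqP.
Qed.

(** Adding the differences of [h] along arcs telescopes on paths and changes no path cost, since [h]
    vanishes at the source and at [v]; the recursion for [h] makes non-basic arcs free. *)
Lemma exists_reduced_form v c : exists r, is_reduced_form G v c r.
Proof.
have [h hE] := exists_potential v c.
have h0 x : ~~ transshipment G v x -> h x = 0.
  move=> xN; rewrite hE big1 // => e /andP[/and3P[_ et _] /eqP ex].
  by rewrite -ex et in xN.
exists (\col_e if e \in arcs_to G v
  then c e 0 + (h (dst G e) - h (src G e)) else 0); split.
- by move=> e /negbTE eA; rewrite mxE eA.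
- move=> p pP; have [dP /allP pA] := andP pP.
  rewrite !lin_costE ?(dipath_uniq dP) //.
  rewrite [RHS]big_seq; under [RHS]eq_bigr => e ep do rewrite mxE pA //.
  rewrite -big_seq big_split /= (sum_potential _ dP).
  by rewrite !h0 ?subrr ?addr0 // /transshipment eqxx ?andbF.
- move=> e eN; rewrite mxE; case: ifP => // _.
  (* Only one non-basic arc leaves [src G e], so the sum has the single term [e]. *)
  rewrite [h (src G e)]hE (big_pred1 e) ?addrA ?subrr // => f /=.
  apply/andP/eqP => [[fN /eqP fe]|->]; last by [].
  exact: nonbasic_unique fN eN fe.
Qed.

Lemma reduced_formP v c : is_reduced_form G v c (reduced_form G v c).
Proof. by apply: xgetPex; apply: exists_reduced_form. Qed.

(** * The linear system of the critical paths *)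

Section CriticalPaths.
Variables (v : 'I_n.+1) (P : 'I_m -> seq 'I_m).
Hypothesis P_critical : forall e, basic G v e -> critical_path G v e (P e).

(* The arcs of [P e] other than [e] are non-basic or start before [e], so the
   system is triangular. *)
Lemma critical_paths_independent c :
  cost_vector G v c -> (forall e, nonbasic G v e -> c e 0 = 0) ->
  (forall e, basic G v e -> lin_cost c (P e) = 0) -> c = 0.
Proof.
move=> cA cN cB; apply/colP=> e; rewrite [RHS]mxE.
have [k] := ubnP (src G e); elim: k e => // k IH e ek.
case eA: (e \in arcs_to G v); last by rewrite cA ?eA.
case eN: (nonbasic G v e); first exact: cN.
have eB : basic G v e by rewrite /basic eA eN.
have [/andP[PP _]] := (critical_dipath (P_critical eB), cB e eB).
case: (P_critical eB) => p1 [p2 [Pe /andP[p1P _] _ /allP p2N]].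
rewrite lin_costE ?(dipath_uniq PP) // Pe big_cat big_cons /=.
rewrite big_seq big1 ?add0r => [|f fp1]; last first.
  by apply: IH; apply: leq_trans (dipath_src_lt p1P fp1) _.
by rewrite big_seq big1 ?addr0 // => f /p2N/cN.
Qed.

Lemma equal_on_critical_paths c r :
  cost_vector G v c -> (forall e, nonbasic G v e -> c e 0 = 0) ->
  cost_vector G v r -> (forall e, nonbasic G v e -> r e 0 = 0) ->
  (forall e, basic G v e -> lin_cost c (P e) = lin_cost r (P e)) -> c = r.
Proof.
move=> cA cN rA rN cr; apply/eqP; rewrite -subr_eq0; apply/eqP.
apply: critical_paths_independent => [e eA|e eN|e eB].
- by rewrite !mxE cA // rA // subrr.
- by rewrite !mxE cN // rN // subrr.
- by rewrite lin_costD lin_costN cr // subrr.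
Qed.

Lemma pseudo_linearizationP :
  is_pseudo_linearization G Q v P (pseudo_linearization G Q v P).
Proof.
apply: xgetPex.
(* The rows of basic arcs evaluate the critical paths; the unit rows force zeros at all other
   arcs. *)
pose M : 'M[R]_m := \matrix_(e, f)
  if basic G v e then charvec R (P e) f 0 else (e == f)%:R.
have MB c e : basic G v e -> (M *m c) e 0 = lin_cost c (P e).
  move=> eB; rewrite /lin_cost !mxE; apply: eq_bigr => f _.
  by rewrite !mxE eB mulrC.
have MN c e : ~~ basic G v e -> (M *m c) e 0 = c e 0.
  move=> /negbTE eB; rewrite mxE (bigD1 e) //= mxE eB eqxx mul1r.
  rewrite big1 ?addr0 // => f; rewrite mxE eB eq_sym => /negbTE ->.
  by rewrite mul0r.
have NB e : nonbasic G v e -> ~~ basic G v e by rewrite /basic => ->; rewrite andbF.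
have AB e : e \notin arcs_to G v -> ~~ basic G v e by rewrite /basic => /negbTE->.
have [] := @solvable_of_injective _ _ M
    (\col_e if basic G v e then quad_cost G Q v (P e) else 0).
  move=> c /colP c0; apply: critical_paths_independent => e eP.
  - by rewrite -MN ?c0 ?mxE ?AB.
  - by rewrite -MN ?c0 ?mxE ?NB.
  - by rewrite -MB ?c0 ?mxE.
move=> c /colP cM; exists c; split=> e eP.
- by rewrite -MN ?cM ?mxE ?AB // (negbTE (AB _ eP)).
- by rewrite -MN ?cM ?mxE ?NB // (negbTE (NB _ eP)).
- by rewrite -MB ?cM ?mxE ?eP.
Qed.

(** Critical paths are source-[v] paths and reduction preserves path costs, so both vectors solve
    the same uniquely solvable system. *)
Lemma reduced_linearization c :
  (forall p, dipath_in G v source p v -> quad_cost G Q v p = lin_cost c p) ->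
  reduced_form G v c = pseudo_linearization G Q v P.
Proof.
move=> cL; have [rA rc rN] := reduced_formP v c.
have [pA pN pP] := pseudo_linearizationP.
apply: equal_on_critical_paths => // e eB.
have PP := critical_dipath (P_critical eB).
by rewrite -pP // cL // rc.
Qed.

End CriticalPaths.
End Costs.

Theorem theorem7p8 (R : realType) (n m : nat) (G : dag n m) (Q : 'M[R]_m)
    (P : 'I_n.+1 -> 'I_m -> seq 'I_m)
    (hG : forall x : 'I_n.+1, on_path G source target x)
    (hQsym : Q^T = Q)
    (hQdiag : forall e : 'I_m, Q e e = 0)
    (hP : forall (v : 'I_n.+1) (e : 'I_m),
        basic G v e -> critical_path G v e (P v e)) :
  let p := fun v : 'I_n.+1 => pseudo_linearization G Q v (P v) in
  linearization G Q target (p target) <->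
  (forall e : 'I_m,
     reduced_form G (src G e) (pull_back G Q e (p (dst G e))) = p (src G e)).
Proof.
move=> p; have pP v := pseudo_linearizationP Q (hP v).
have lin0 : linearization G Q source (p source).
  split=> [|q]; first by case: (pP source).
  rewrite dipath_inE => /dipath_loop ->.
  by rewrite quad_costE // lin_costE // !big_nil.
split=> [pt|pe].
- have pull e : linearization G Q (dst G e) (p (dst G e)) ->
      reduced_form G (src G e) (pull_back G Q e (p (dst G e))) = p (src G e).
    move=> [_ pe]; apply: (reduced_linearization (hP _)); move=> q qP.
    (* For an arc leaving the source, the only path to its tail is empty and both costs are zero. *)
    have [es|es] := eqVneq (src G e) source.
      rewrite dipath_inE in qP; rewrite quad_costE //.
      move: qP; rewrite es => /dipath_loop ->.
      by rewrite lin_costE // !big_nil.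
    rewrite dipath_inE in qP; rewrite lin_cost_pull_back // -pe.
      by rewrite quad_cost_rcons // addrK.
    by rewrite dipath_inE dipath_rcons qP /=.
  have plin v : linearization G Q v (p v).
    (* Descending induction: [hG] provides an arc [e] leaving [v], whose head is already settled. *)
    have [k] := ubnP (n - v); elim: k v => // k IH v vk.
    have [->//|vt] := eqVneq v target.
    have /on_pathP[_ [[|e q] [_ /=]]] := hG v; first by rewrite (negbTE vt).
    case/andP=> /eqP ev _; subst v.
    have lin : linearization G Q (dst G e) (p (dst G e)).
      by apply: IH; move: vk (topological G e) (ltn_ord (dst G e)) => *; lia.
    have [->//|es] := eqVneq (src G e) source.
    split=> [|r rP]; first by case: (pP (src G e)).
    (* By [pull], the vector at the tail is a reduced form of the pull-back, hence agrees with it on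
       all paths. *)
    have [_ req _] := reduced_formP G (src G e) (pull_back G Q e (p (dst G e))).
    rewrite -pull // -req //; rewrite dipath_inE in rP.
    rewrite lin_cost_pull_back // -(proj2 lin) ?quad_cost_rcons ?addrK //.
    by rewrite dipath_inE dipath_rcons rP /=.
  by move=> e; apply: pull.
- suff plin v : linearization G Q v (p v) by [].
  (* Ascending induction, splitting off the last arc [e] of a path. *)
  have [k] := ubnP v; elim: k v => // k IH v vk.
  split=> [|q]; first by case: (pP v).
  rewrite dipath_inE; case/lastP: q => [|q e].
    by move=> /= /eqP <-; apply: (proj2 lin0); rewrite dipath_inE.
  move=> qeP; move: (qeP); rewrite dipath_rcons => /andP[qP /eqP ev].
  (* [G_source] has no arcs, so the hypothesis says nothing about an arc [e]
     leaving the source; but then [e] alone is the critical path of [e]. *)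
  have [es|es] := eqVneq (src G e) source.
    have eB : basic G v e.
      rewrite /basic /nonbasic /transshipment es eqxx !andbF andbT.
      move: qeP; rewrite -dipath_inE => /andP[_ /allP->//].
      by rewrite mem_rcons mem_head.
    case: (pP v) => _ _ /(_ e eB); case: (hP v e eB) => p1 [p2 [->]].
    rewrite es => /andP[/dipath_loop-> _]; rewrite ev => /andP[/dipath_loop-> _] _.
    by move: qP; rewrite es => /dipath_loop->.
  have [_ req _] := reduced_formP G (src G e) (pull_back G Q e (p v)).
  have qP' : dipath_in G (src G e) source q (src G e) by rewrite dipath_inE.
  have /IH[_ /(_ q qP')] : (src G e < k)%N.
    by rewrite -ltnS (leq_trans _ vk) // -ev ltnS topological.
  (* The increment caused by [e] cancels against the one subtracted in the pull-back. *)
  rewrite -ev quad_cost_rcons // => ->; rewrite -pe ev -req //.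
  by rewrite lin_cost_pull_back // subrK.
Qed.
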